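(* Let $k\ge 1$ and let $\mathcal{L}=\{\mathcal{M}_1,\dots,\mathcal{M}_k\}$ be a system of $k$ loopless matroids on the same finite non-empty ground set $V$, and let $\bigcap\mathcal{L}=\bigcap_{i=1}^k\mathcal{M}_i$. For $U\subseteq V$ let $\mathcal{L}_U=\{\mathcal{M}_1[U],\dots,\mathcal{M}_k[U]\}$. Then $$R(\mathcal{L}):Q\big(\bigcap\mathcal{L}\big)=\max_{\emptyset\ne U\subseteq V}\frac{\bar{\nu}^*(\mathcal{L}_U)}{\bar{\nu}(\mathcal{L}_U)}.$$
   Context: A complex on $V$ is a non-empty family of subsets of $V$ closed under taking subsets; a matroid is identified with the complex of its independent sets; loopless means every singleton is independent. For a complex $\mathcal{C}$ and $U\subseteq V$, $\mathcal{C}[U]=\{S\in\mathcal{C}:S\subseteq U\}$ (so $\mathcal{M}_i[U]$ is the restriction of $\mathcal{M}_i$ to $U$), and $\mathrm{rank}_{\mathcal{C}}(U)=\max_{S\in\mathcal{C}[U]}|S|$. For $f\in\mathbb{R}^V$ and $S\subseteq V$ write $f[S]=\sum_{v\in S}f(v)$. For a complex $\mathcal{C}$ on $V$, $P(\mathcal{C})\subseteq\mathbb{R}^V_{\ge 0}$ is the convex hull of the characteristic vectors $\mathbf{1}_S$, $S\in\mathcal{C}$, and $$Q(\mathcal{C})=\{f\in\mathbb{R}^V_{\ge 0}: f[S]\le\mathrm{rank}_{\mathcal{C}}(S)\text{ for every }S\subseteq V\}.$$ For a system $\mathcal{L}=\{\mathcal{M}_1,\dots,\mathcal{M}_k\}$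 of matroids on the same ground set, $R(\mathcal{L})=\bigcap_{i=1}^kP(\mathcal{M}_i)$; $\bar{\nu}^*(\mathcal{L})$ is the maximum of $\sum_{v}x(v)$ (sum over the ground set) over $x\in R(\mathcal{L})$; and $\bar{\nu}(\mathcal{L})$ is the maximum size of a set in $\bigcap\mathcal{L}$. A polytope $Z\subseteq\mathbb{R}^V_{\ge 0}$ is closed down if $z\in Z$ and $0\le y\le z$ imply $y\in Z$. For closed-down polytopes $A,B\subseteq\mathbb{R}^V_{\ge 0}$, $B:A=\min\{t\in\mathbb{R}_{\ge 0}: tA\supseteq B\}$ ($\min\emptyset=\infty$), where $tA=\{ta:a\in A\}$. *)

(* Defs.v *)
From HB Require Import structures.
From mathcomp Require Import all_boot all_order all_algebra.
From mathcomp Require Import all_classical all_reals all_analysis.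
Import Order.TTheory GRing.Theory Num.Theory.
Import numFieldNormedType.Exports.

Set Implicit Arguments.
Unset Strict Implicit.
Unset Printing Implicit Defensive.

Local Open Scope classical_set_scope.
Local Open Scope ring_scope.

Definition is_complex (V : finType) (C : {set {set V}}) : Prop :=
  (exists S : {set V}, S \in C) /\
  (forall S T : {set V}, T \in C -> S \subset T -> S \in C).

Definition is_matroid (V : finType) (M : {set {set V}}) : Prop :=
  is_complex M /\
  (forall I J : {set V}, I \in M -> J \in M -> (#|I| < #|J|)%N ->
    exists2 v : V, v \in (J :\: I)%SET & (v |: I)%SET \in M).

Definition loopless (V : finType) (M : {set {set V}}) : Prop :=
  forall v : V, [set v]%SET \in M.

(* C[U], still a family of subsets of the ambient type V; its ground set U is
   passed separately where it matters (see nubar_star). *)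
Definition restr (V : finType) (C : {set {set V}}) (U : {set V}) :
  {set {set V}} := [set S in C | S \subset U]%SET.

Definition rank (V : finType) (C : {set {set V}}) (U : {set V}) : nat :=
  \max_(S in restr C U) #|S|.

(* Maximum of a set of reals; the default 0 is returned only if no maximum
   exists. *)
Definition maximum (R : realType) (A : set R) : R := xget 0 (A `&` ubound A).

(* Minimum in the extended reals of a set of reals; the default +oo implements
   min(empty) = +oo (and is the junk value when a minimum is not attained). *)
Definition minimum (R : realType) (A : set R) : \bar R :=
  xget +oo%E [set t%:E | t in A `&` lbound A].

Definition convex_hull (R : realType) (V : finType) (A : set (V -> R)) :
  set (V -> R) :=
  [set x | exists (n : nat) (p : 'I_n -> V -> R) (w : 'I_n -> R),
    [/\ forall i, A (p i), forall i, 0 <= w i, \sum_i w i = 1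
      & x = \sum_i w i *: p i]].

Definition charvec (R : realType) (V : finType) (S : {set V}) : V -> R :=
  fun v => (v \in S)%:R.

Arguments charvec R {V} S.

Definition P (R : realType) (V : finType) (C : {set {set V}}) : set (V -> R) :=
  convex_hull [set charvec R S | S in [set S : {set V} | S \in C]].

Arguments P R {V} C.

Definition Q (R : realType) (V : finType) (C : {set {set V}}) : set (V -> R) :=
  [set f | (forall v, 0 <= f v) /\
           (forall S : {set V}, \sum_(v in S) f v <= (rank C S)%:R)].

Arguments Q R {V} C.

Definition meet (V : finType) (k : nat) (L : 'I_k -> {set {set V}}) :
  {set {set V}} := (\bigcap_(i < k) L i)%SET.

Definition Rpoly (R : realType) (V : finType) (k : nat)
  (L : 'I_k -> {set {set V}}) : set (V -> R) :=
  [set x | forall i : 'I_k, P R (L i) x].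

Arguments Rpoly R {V k} L.

Definition restr_sys (V : finType) (k : nat) (L : 'I_k -> {set {set V}})
  (U : {set V}) : 'I_k -> {set {set V}} := fun i => restr (L i) U.

(* E is the common ground set of the members of L. When the complexes consist
   of subsets of E, the vectors in Rpoly R L vanish outside E, so Rpoly R L is
   the polytope in R^E extended by zero. *)
Definition nubar_star (R : realType) (V : finType) (E : {set V}) (k : nat)
  (L : 'I_k -> {set {set V}}) : R :=
  maximum [set \sum_(v in E) x v | x in Rpoly R L].

Arguments nubar_star R {V} E {k} L.

Definition nubar (V : finType) (k : nat) (L : 'I_k -> {set {set V}}) : nat :=
  \max_(S in meet L) #|S|.

(* colon B A is B : A = min {t >= 0 | B is contained in t A}. *)
Definition colon (R : realType) (V : finType) (B A : set (V -> R)) : \bar R :=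
  minimum [set t : R | 0 <= t /\ B `<=` [set t *: a | a in A]].

(* Main.v *)
Require Import Defs.
From mathcomp Require Import all_boot all_order all_algebra.
From mathcomp Require Import all_classical all_reals all_analysis.
Import Order.TTheory GRing.Theory Num.Theory numFieldNormedType.Exports.
Local Open Scope classical_set_scope.
Local Open Scope ring_scope.

Set Implicit Arguments.
Unset Strict Implicit.
Unset Printing Implicit Defensive.

(** Write [C] for the intersection of the matroids, [R] for [R(L)] and [r U] for
the ratio of the fractional to the integral optimum of the restricted system.
For [t > 0] the inclusion of [R] in [t Q(C)] says that [x[U] <= t * rank_C(U)]
for all [x] in [R] and all [U]: the defining inequalities of [Q(C)], scaled
by [t]. Maximising over [x], it says that [max_(x in R) x[U] <= t * rank_C(U)] for
all [U], so the least [t] is the largest of the quotients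
[max_(x in R) x[U] / rank_C(U)] over nonempty [U]. It remains to see that such a
quotient is [r U].

The denominators agree because the sets in all [M_i[U]] are the sets of [C]
inside [U] ([nubar_restr_sys]). The numerators agree because maximising [x[U]]
over [R(L)] or over [R(L_U)] gives the same value ([nubar_starP]): each
[P(M_i[U])] is contained in [P(M_i)], and erasing the coordinates outside [U]
maps [P(M_i)] into [P(M_i[U])] ([P_restrict]) without changing [x[U]].

Both steps presuppose that the maxima are attained. Each [P(M_i)] is the
continuous image of a simplex, so [R] is compact ([compact_Rpoly]). Looplessness
makes [rank_C(U)] positive for nonempty [U] ([rank_meet_gt0]) and puts the
characteristic vectors of singletons into [R], so the optimal [t] is
positive. *)

(** * Attained maxima and minima *)

Lemma maximum_unique (R : realType) (A : set R) (m : R) :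
  A m -> ubound A m -> maximum A = m.
Proof.
move=> Am ubm; apply: xget_unique => [|y [Ay uby]]; first by split.
by apply/le_anti; rewrite ubm //= uby.
Qed.

Lemma minimum_unique (R : realType) (A : set R) (m : R) :
  A m -> lbound A m -> minimum A = m%:E.
Proof.
move=> Am lbm; apply: xget_unique => [|_ [y [Ay lby] <-]]; first by exists m.
by congr (_%:E); apply/le_anti; rewrite lby //= lbm.
Qed.

Lemma maximum_image_finite (R : realType) (T : finType) (D : {pred T})
    (F : T -> R) (t0 : T) (Dt0 : t0 \in D) :
  exists2 t : T, t \in D /\ maximum [set F t | t in [set t | t \in D]] = F t &
    forall s, s \in D -> F s <= F t.
Proof.
case: (arg_maxP F Dt0) => t Dt max_t; exists t; last exact: max_t.
split=> //; apply: maximum_unique; first by exists t.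
by move=> _ [s Ds <-]; exact: max_t.
Qed.

(** * Compactness of the polytopes *)

Section ConvexHullCompact.
Import ArrowAsProduct.
Variable R : realType.

Lemma continuous_coordinatewise (T : topologicalType) (V : Type)
    (K : V -> topologicalType) (f : T -> prod_topology K) :
  (forall v, continuous (fun x => f x v)) -> continuous f.
Proof.
move=> f_cont x; apply/cvg_sup => v U [_ [[W oW <-] /= Wfx]] /filterS; apply.
by apply: (f_cont v x); exact: open_nbhs_nbhs.
Qed.

Definition simplex (I : finType) : set (I -> R) :=
  [set w | (forall i, 0 <= w i) /\ \sum_i w i = 1].
Arguments simplex : clear implicits.

Lemma continuous_weighted_sum (I : finType) (c : I -> R) :
  continuous (fun w : I -> R => \sum_i w i * c i).
Proof.
apply: continuous_big => [|i _ w]; first exact: add_continuous.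
have := @mulrr_continuous R (c i) (proj i w).
exact: continuous_comp (@proj_continuous I (fun=> R) i w).
Qed.

(** By Tychonoff's theorem: a simplex is a closed slice of a cube. *)
Lemma compact_simplex (I : finType) : compact (simplex I).
Proof.
have cube_compact : compact [set w : I -> R | forall i, `[0, 1]%classic (w i)].
  by apply: (@tychonoff I (fun=> R) (fun=> `[0, 1]%classic)) => _;
    exact: segment_compact.
(* The factors [1] give the sum the shape of [continuous_weighted_sum]. *)
have sum_closed : closed [set w : I -> R | \sum_i w i * 1 = 1].
  apply: (@preimage_closed (I -> R) R (fun w => \sum_i w i * 1) [set 1]).
    by move=> w _; exact: continuous_weighted_sum.
  exact: closed_eq.
rewrite (_ : simplex I = [set w | forall i, `[0, 1]%classic (w i)] `&`
                         [set w | \sum_i w i * 1 = 1]).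
  exact: compact_closedI.
apply/seteqP; split=> w /=; under [X in X = 1]eq_bigr do rewrite mulr1.
  case=> w_ge0 w1; split=> // i; rewrite in_itv /= w_ge0 /= -w1.
  by rewrite (bigD1 i) //= lerDl sumr_ge0.
by case=> w01 w1; split=> // i; have := w01 i; rewrite in_itv => /andP[].
Qed.

(** A convex combination may repeat points and have any length; adding up the
weights of equal points leaves one weight for each point of the family. This
parametrises the hull by a single simplex, which is what makes it compact. *)
Lemma convex_hull_finite (V I : finType) (p : I -> V -> R) :
  convex_hull [set p i | i in [set: I]] =
  [set (fun v => \sum_i w i * p i v) | w in simplex I].
Proof.
apply/seteqP; split=> [x [n [q [w [pq w_ge0 w1 ->]]]]|_ [w [w_ge0 w1] <-]].
  (* [p] need not be injective: [f] picks one index for each point used. *)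
  have /choice[f fq] : forall j, exists i, p i = q j.
    by move=> j; have [i _ <-] := pq j; exists i.
  exists (fun i => \sum_(j | f j == i) w j).
    split=> [i|]; first exact: sumr_ge0.
    by rewrite -w1 [RHS](partition_big f xpredT).
  apply/funext => v; rewrite fct_sumE [RHS](partition_big f xpredT) //=.
  apply: eq_bigr => i _; rewrite mulr_suml; apply: eq_bigr => j /eqP <-.
  by rewrite fq.
exists #|I|, (fun j => p (enum_val j)), (fun j => w (enum_val j)); split => //.
- by rewrite -(big_enum_val w).
- apply/funext => v.
  by rewrite fct_sumE -(big_enum_val (fun i => w i * p i v)).
Qed.

Lemma compact_convex_hull (V I : finType) (p : I -> V -> R) :
  compact (convex_hull [set p i | i in [set: I]]).
Proof.
rewrite convex_hull_finite; apply: continuous_compact; last exact: compact_simplex.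
apply: continuous_subspaceT.
apply: (@continuous_coordinatewise (I -> R) V (fun=> R)) => v.
exact: (@continuous_weighted_sum I (fun i => p i v)).
Qed.

Lemma compact_P (V : finType) (C : {set {set V}}) : compact (P R C).
Proof.
rewrite /P (_ : [set charvec R S | S in _] =
  [set charvec R (val S) | S in [set: {S : {set V} | S \in C}]]).
  exact: compact_convex_hull.
apply/seteqP; split=> [_ [S CS <-]|_ [[S CS] _ <-]]; last by exists S.
by exists (exist _ S CS).
Qed.

(** A closed part of any one of the compact polytopes intersected; with none of
them ([k = 0]) it would be the whole space. *)
Lemma compact_Rpoly (V : finType) (k : nat) (L : 'I_k -> {set {set V}}) :
  (0 < k)%N -> compact (Rpoly R L).
Proof.
move=> k_gt0; have i0 : 'I_k by exists 0.
have closed_P C : closed (P R C).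
  apply: compact_closed (@compact_P _ _).
  by apply: hausdorff_product => _; exact: Rhausdorff.
apply: (@subclosed_compact _ _ (P R (L i0))); last by move=> x; apply.
- rewrite (_ : Rpoly R L = \bigcap_(i in [set: 'I_k]) P R (L i)).
    by apply: closed_bigI => i _; exact: closed_P.
  by apply/seteqP; split=> x h i //; exact: h.
- exact: compact_P.
Qed.

Lemma Rpoly_attains (V : finType) (E : {set V}) (k : nat)
    (L : 'I_k -> {set {set V}}) :
  (0 < k)%N -> Rpoly R L !=set0 ->
  exists2 x, Rpoly R L x & forall y, Rpoly R L y ->
    \sum_(v in E) y v <= \sum_(v in E) x v.
Proof.
move=> k_gt0 R_neq0.
have sum_continuous : continuous (fun x : V -> R => \sum_v x v * (v \in E)%:R).
  exact: continuous_weighted_sum.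
have [x /set_mem Rx x_max] := compact_EVT_max R_neq0 (compact_Rpoly k_gt0)
  (continuous_subspaceT sum_continuous).
have sumE (y : V -> R) : \sum_v y v * (v \in E)%:R = \sum_(v in E) y v.
  by rewrite [RHS]big_mkcond; apply: eq_bigr => v _; case: ifP; rewrite (mulr1,mulr0).
by exists x => // y Ry; rewrite -!sumE; apply: x_max; exact: mem_set.
Qed.

End ConvexHullCompact.

(** * Restricting a system to a subset of the ground set *)

Section Restriction.
Variables (R : realType) (V : finType).
Implicit Types (C : {set {set V}}) (U S : {set V}) (x : V -> R).

Lemma P_ge0 C x v : P R C x -> 0 <= x v.
Proof.
move=> [n [p [w [Cp w_ge0 _ ->]]]]; rewrite fct_sumE; apply: sumr_ge0 => i _.
by have [S _ <-] := Cp i; rewrite mulr_ge0 // ler0n.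
Qed.

Lemma charvec_P C S : S \in C -> P R C (charvec R S).
Proof.
move=> CS; exists 1, (fun=> charvec R S), (fun=> 1); split=> //.
- by move=> _; exists S.
- by rewrite big_ord1.
- by rewrite big_ord1 scale1r.
Qed.

Lemma P_restr_sub C U : P R (restr C U) `<=` P R C.
Proof.
move=> x [n [p [w [Cp w_ge0 w1 ->]]]]; exists n, p, w; split=> // i.
by have [S] := Cp i; rewrite /= inE => /andP[CS _] <-; exists S.
Qed.

(** Erasing the coordinates outside [U] turns the vertex of [S] into the vertex
of [S :&: U], which belongs to [C] since a complex is closed under subsets. *)
Lemma P_restrict C U x : is_complex C -> P R C x ->
  P R (restr C U) (fun v => (v \in U)%:R * x v).
Proof.
move=> [_ C_down] [n [p [w [Cp w_ge0 w1 ->]]]].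
exists n, (fun i v => (v \in U)%:R * p i v), w; split=> //.
- move=> i; have [S CS <-] := Cp i; exists (S :&: U)%SET.
    by rewrite /= inE finset.subsetIr (C_down _ _ CS) ?finset.subsetIl.
  by apply/funext => v; rewrite /charvec finset.in_setI andbC -mulnb natrM.
- apply/funext => v; rewrite !fct_sumE mulr_sumr; apply: eq_bigr => i _.
  by rewrite -[RHS]/(w i * _) -[(w i *: p i) v]/(w i * _) mulrCA.
Qed.

Variables (k : nat) (L : 'I_k -> {set {set V}}).
Hypotheses (k_gt0 : (0 < k)%N) (L_complex : forall i, is_complex (L i)).

Lemma nubar_restr_sys U : nubar (restr_sys L U) = rank (meet L) U.
Proof.
apply: eq_bigl => S; rewrite inE; apply/bigcapP/andP => [LS|[/bigcapP LS SU] i _].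
  split; last by have := LS (Ordinal k_gt0) isT; rewrite inE => /andP[].
  by apply/bigcapP => i _; have := LS i isT; rewrite inE => /andP[].
by rewrite inE LS.
Qed.

(** The polytope of the restricted system is both a part of [Rpoly R L] and its
image under erasing the coordinates outside [U], which [x[U]] does not see; so
the two polytopes give [x[U]] the same maximum. *)
Lemma nubar_starP U :
  (exists2 x, Rpoly R L x & \sum_(v in U) x v = nubar_star R U (restr_sys L U)) /\
  (forall y, Rpoly R L y -> \sum_(v in U) y v <= nubar_star R U (restr_sys L U)).
Proof.
have restrict_Rpoly y : Rpoly R L y ->
    Rpoly R (restr_sys L U) (fun v => (v \in U)%:R * y v).
  by move=> Ry i; apply: P_restrict.
have [|x Rx x_max] := @Rpoly_attains R V U k (restr_sys L U) k_gt0.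
  exists (charvec R finset.set0) => i; apply: charvec_P.
  have [[S LS] L_down] := L_complex i.
  by rewrite inE finset.sub0set (L_down _ _ LS) ?finset.sub0set.
have -> : nubar_star R U (restr_sys L U) = \sum_(v in U) x v.
  by apply: maximum_unique; [exists x | move=> _ [y Ry <-]; exact: x_max].
split; first by exists x => // i; exact: P_restr_sub (Rx i).
move=> y /restrict_Rpoly /x_max; congr (_ <= _).
by apply: eq_bigr => v Uv; rewrite Uv mul1r.
Qed.

End Restriction.

(** * The ratio formula *)

Lemma rank_meet_gt0 (V : finType) (k : nat) (L : 'I_k -> {set {set V}})
    (U : {set V}) :
  (forall i, loopless (L i)) -> U != finset.set0 -> (0 < rank (meet L) U)%N.
Proof.
move=> L_loopless /set0Pn[v Uv].
apply: leq_trans (leq_bigmax_cond _ (_ : [set v]%SET \in _)).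
  by rewrite cards1.
by rewrite inE finset.sub1set Uv andbT; apply/bigcapP => i _; exact: L_loopless.
Qed.

Theorem theorem10p7 (R : realType) (V : finType) (k : nat)
  (L : 'I_k -> {set {set V}})
  (V_nonempty : (0 < #|V|)%N) (k_ge1 : (1 <= k)%N)
  (L_matroid : forall i, is_matroid (L i))
  (L_loopless : forall i, loopless (L i)) :
  colon (Rpoly R L) (Q R (meet L)) =
  (maximum [set nubar_star R U (restr_sys L U) / (nubar (restr_sys L U))%:R
           | U in [set U : {set V} | U != finset.set0]])%:E.
Proof.
have L_complex i : is_complex (L i) by case: (L_matroid i).
have [v0 _] : exists v0 : V, v0 \in V by apply/card_gt0P.
have v0_neq0 : [set v0]%SET != finset.set0
  by apply/set0Pn; exists v0; rewrite finset.set11.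
pose r (U : {set V}) : R :=
  nubar_star R U (restr_sys L U) / (nubar (restr_sys L U))%:R.
have nubar_starE U : U != finset.set0 ->
    nubar_star R U (restr_sys L U) = r U * (rank (meet L) U)%:R.
  move=> U_neq0; rewrite /r (nubar_restr_sys L k_ge1) divfK // pnatr_eq0.
  by rewrite -lt0n rank_meet_gt0.
have [U [U_neq0 ->] r_max] := @maximum_image_finite R _
  [pred U : {set V} | U != finset.set0] r _ v0_neq0.
have [[x Rx x_max] _] := nubar_starP R k_ge1 L_complex U.
have rU_gt0 : 0 < r U.
  apply: lt_le_trans (r_max _ v0_neq0); apply: divr_gt0.
    have [_ star_ge] := nubar_starP R k_ge1 L_complex [set v0]%SET.
    apply: lt_le_trans (star_ge (charvec R [set v0]%SET) _).
      by rewrite big_set1 /charvec finset.set11.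
    by move=> i; apply: charvec_P; exact: L_loopless.
  by rewrite (nubar_restr_sys L k_ge1) ltr0n rank_meet_gt0.
(* The quotients bound every inequality of [Q] at the scale [r U], and the
   maximiser [x] for [U] makes the inequality of [U] tight. *)
apply: minimum_unique.
  split=> [|y Ry]; first exact: ltW.
  exists ((r U)^-1 *: y); last by rewrite scalerA divff ?gt_eqF ?scale1r.
  split=> [v|S].
    by rewrite mulr_ge0 ?invr_ge0 ?(ltW rU_gt0) // (P_ge0 v (Ry (Ordinal k_ge1))).
  rewrite -mulr_sumr mulrC ler_pdivrMr //.
  (* The inequality of the empty set is not covered by the quotients. *)
  have [->|S_neq0] := eqVneq S finset.set0.
    by rewrite big_set0 mulr_ge0 // ltW.
  have [_ /(_ y Ry) y_le] := nubar_starP R k_ge1 L_complex S.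
  apply: le_trans y_le _; rewrite nubar_starE // mulrC.
  by rewrite ler_wpM2l // r_max.
move=> t [t_ge0 /(_ x Rx) [a [_ a_le] tax]].
rewrite /r (nubar_restr_sys L k_ge1) ler_pdivrMr ?ltr0n ?rank_meet_gt0 //.
rewrite -x_max -tax -mulr_sumr.
by rewrite ler_wpM2l.
Qed.
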